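(* Assume that the natural exponential family $\mathcal F=\{G_\theta:\theta\in\Theta\}$ has a separable moment sequence $\{\tilde c_n(\theta)\}_{n\ge0}$ at $\theta_0\in\Theta$ (with associated $\zeta,\xi,\{\tilde a_n\}$), and let $\omega$ be admissible. For $t,x\in\mathbb{R}$ set $$K(t,x;\theta_0)=\frac1{\zeta(\theta_0)}\int_{[-1,1]}\sum_{n=0}^\infty\frac{(-tsx)^n\cos\{\frac\pi2n+ts\xi(\theta_0)\}}{\tilde a_nn!}\,\omega(s)\,ds .$$ Then for $\theta\in\Theta$, $$\psi(t,\theta;\theta_0)=\int K(t,x;\theta_0)\,dG_\theta(x)=\frac{\zeta(\theta)}{\zeta(\theta_0)}\int_{[-1,1]}\cos[ts\{\xi(\theta_0)-\xi(\theta)\}]\,\omega(s)\,ds,$$ $\psi(t,\theta_0;\theta_0)=1$ for any $t$, and $\lim_{t\to\infty}\psi(t,\theta;\theta_0)=0$ for each $\theta\ne\theta_0$.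
   Context: $\beta$ is a positive Radon measure on $\mathbb{R}$ not concentrated on one point, $L(\theta)=\int e^{x\theta}\beta(dx)$, $\Theta$ is the maximal open set of $\theta\in\mathbb{R}$ on which $L(\theta)<\infty$, and $G_\theta(dx)=\exp\{\theta x-\ln L(\theta)\}\beta(dx)$ for $\theta\in\Theta$. Standing assumptions: the family $\mathcal F$ is not a location-shift family, its members are continuous distributions, $0\in\Theta$, and $\beta$ is a probability measure with finite moments of all orders. Let $\tilde c_n(\theta)=\int x^n\,dG_\theta(x)$, $n\in\mathbb{N}=\{0,1,2,\dots\}$. The moment sequence $\{\tilde c_n(\theta)\}_{n\ge0}$ is separable at $\theta_0$ if there exist functions $\zeta,\xi:\Theta\to\mathbb{R}$ and a real sequence $\{\tilde a_n\}_{n\ge0}$ (of non-zero numbers) such that: (i) $\xi(\theta)\ne\xi(\theta_0)$ whenever $\theta\ne\theta_0$, $\zeta(\theta)\neq0$ for all $\theta\in\Theta$, and $\zeta$ does not depend on $n$; (ii) $\tilde c_n(\theta)=\xi^n(\theta)\zeta(\theta)\tilde a_n$ for each $n\in\mathbb{N}$ and $\theta\in\Theta$; (iii) $\Psi(t,\theta)=\sum_{n=0}^\infty\frac{t^n\xi^n(\theta)}{\tilde a_nn!}$ is absolutely convergent pointwise in $(t,\theta)\in\mathbb{R}\times\Theta$. $\omega:[-1,1]\to\mathbb{R}$ is admissible if it is non-negative and bounded with $\int_{[-1,1]}\omega(s)ds=1$. *)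

(* Defs.v *)
From HB Require Import structures.
From mathcomp Require Import all_boot all_order all_algebra.
From mathcomp Require Import all_classical all_reals all_analysis measurable_realfun.

Set Implicit Arguments.
Unset Strict Implicit.
Unset Printing Implicit Defensive.

Import Order.TTheory GRing.Theory Num.Theory.
Import numFieldNormedType.Exports.

Local Open Scope classical_set_scope.
Local Open Scope ring_scope.

(** A Borel probability measure on the real line is automatically Radon. *)
Section natural_exponential_family.
Context (R : realType) (beta : probability (measurableTypeR R) R).

Definition laplace (theta : R) : \bar R :=
  (\int[beta]_x (expR (x * theta))%:E)%E.

(** The maximal open subset of [{theta | L theta < +oo}] is its interior. *)
Definition natural_parameter : set R :=
  interior [set theta | (laplace theta < +oo)%E].

Definition nef_density (theta x : R) : R :=
  expR (theta * x - ln (fine (laplace theta))).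

(** Total in [theta]; it is the member of the family, a probability measure,
    only for [theta] in [natural_parameter]. *)
Definition nef (theta : R) (A : set (measurableTypeR R)) : \bar R :=
  (\int[beta]_(x in A) (nef_density theta x)%:E)%E.

Lemma nef0 (theta : R) : nef theta set0 = 0%E.
Proof. by rewrite /nef integral_set0. Qed.

Lemma nef_ge0 (theta : R) A : (0 <= nef theta A)%E.
Proof. by apply: integral_ge0 => x _; rewrite lee_fin expR_ge0. Qed.

Lemma measurable_nef_density (theta : R) :
  measurable_fun [set: measurableTypeR R] (nef_density theta).
Proof.
apply: measurableT_comp; first exact: measurable_expR.
apply: measurable_funB; last exact: measurable_cst.
exact: mulrl_measurable.
Qed.

Lemma nef_sigma_additive (theta : R) : semi_sigma_additive (nef theta).
Proof.
apply: semi_sigma_additive_nng_induced.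
- by apply/measurable_EFinP; exact: measurable_nef_density.
- by move=> x; rewrite lee_fin expR_ge0.
Qed.

HB.instance Definition _ (theta : R) := isMeasure.Build _ _ _
  (nef theta) (nef0 theta) (nef_ge0 theta) (@nef_sigma_additive theta).

Definition not_concentrated_on_one_point : Prop :=
  ~ exists x : R, beta (~` [set x]) = 0%E.

Definition finite_moments : Prop :=
  forall n : nat, beta.-integrable [set: R] (fun x : R => (x ^+ n)%:E).

(** No reference to a particular parametrization: if [X] is distributed as one
    member, every other member is the law of [X + c] for some constant [c]. *)
Definition location_shift_family : Prop :=
  forall theta1 theta2 : R, natural_parameter theta1 ->
    natural_parameter theta2 ->
    exists c : R, forall A : set (measurableTypeR R), measurable A ->
      nef theta2 A = pushforward (nef theta1) (fun x : R => x + c) A.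

Definition continuous_members : Prop :=
  forall theta : R, natural_parameter theta ->
    continuous (fun x : R => fine (nef theta `]-oo, x])).

Definition moment (n : nat) (theta : R) : R :=
  (\int[nef theta]_x (x ^+ n))%R.

(** [zeta] and [xi] are functions on [natural_parameter]; their values
    elsewhere are irrelevant. *)
Record separable_at (theta0 : R) (zeta xi : R -> R) (a : nat -> R) : Prop :=
  SeparableAt {
    separable_a_neq0 : forall n : nat, a n != 0 ;
    separable_xi_neq : forall theta : R, natural_parameter theta ->
      theta != theta0 -> xi theta != xi theta0 ;
    separable_zeta_neq0 : forall theta : R, natural_parameter theta ->
      zeta theta != 0 ;
    separable_moment : forall (n : nat) (theta : R), natural_parameter theta ->
      moment n theta = xi theta ^+ n * zeta theta * a n ;
    separable_abs_cvg : forall t theta : R, natural_parameter theta ->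
      cvgn [normed series
        (fun n : nat => t ^+ n * xi theta ^+ n / (a n * n`!%:R))]
  }.

End natural_exponential_family.

(** [omega] is only used on [[-1, 1]]. Measurability is implicit in the
    existence of its integral, but [Rintegral] is total. *)
Record admissible (R : realType) (omega : R -> R) : Prop := Admissible {
  admissible_measurable : measurable_fun `[(-1 : R), 1] omega ;
  admissible_ge0 : forall s : R, s \in `[-1, 1] -> 0 <= omega s ;
  admissible_bounded : exists M : R, forall s : R, s \in `[-1, 1] ->
    omega s <= M ;
  admissible_integral :
    (\int[lebesgue_measure]_(s in `[(-1 : R), 1]) omega s)%R = 1
}.

Section construction.
Context (R : realType) (beta : probability (measurableTypeR R) R).
Context (zeta xi : R -> R) (a : nat -> R) (omega : R -> R) (theta0 : R).

Definition kernel_term (t x s : R) (n : nat) : R :=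
  (- t * s * x) ^+ n * cos (pi / 2 * n%:R + t * s * xi theta0)
    / (a n * n`!%:R).

Definition kernel_integrand (t x s : R) : R :=
  (\big[+%R/0]_(0 <= n <oo) kernel_term t x s n) * omega s.

Definition K (t x : R) : R :=
  (zeta theta0)^-1 *
    (\int[lebesgue_measure]_(s in `[(-1 : R), 1]) kernel_integrand t x s)%R.

Definition psi (t theta : R) : R := (\int[nef beta theta]_x K t x)%R.

End construction.

(* Main.v *)
Require Import Defs.
From mathcomp Require Import all_boot all_order all_algebra.
From mathcomp Require Import all_classical all_reals all_analysis.
From mathcomp Require Import measurable_realfun ring lra.

Import Order.TTheory GRing.Theory Num.Theory.
Import numFieldNormedType.Exports.

Local Open Scope classical_set_scope.
Local Open Scope ring_scope.

(** Write X for a variable with law [G_theta].  As a function of x, the kernel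
    [K t x] is a power series [sum_n c_n(t) x^n], where
    [c_n(t) = zeta(theta0)^-1 * int (- t s)^n cos(pi n / 2 + t s xi(theta0))
    / (a_n n!) omega(s) ds].  Integrating it term by term against [G_theta]
    replaces [x^n] by the moment [xi(theta)^n zeta(theta) a_n]: the unknown
    [a_n] cancels, and what remains under the integral in s is
    [sum_n y^n cos(pi n / 2 + z) / n!], the Taylor series of [cos (y + z)] at
    z, with [y = - t s xi(theta)] and [z = t s xi(theta0)].  This is the formula
    for [psi] ([psiE]).  The value 1 at [theta0] is then immediate, and the
    limit 0 elsewhere is the Riemann-Lebesgue lemma ([riemann_lebesgue]).

    Both exchanges of sum and integral use dominated convergence
    ([integral_series]).  For the exchange in s, the dominating series is
    [sum_n |r|^n / (|a_n| n!)] with [r = t x].  The exchange in x needs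
    [sum_n |t|^n E|X|^n / (|a_n| n!)] to converge.  For even n, [E|X|^n] is a
    moment and so a multiple of [|a_n|]; but for odd n nothing in the definition
    of separability compares [E|X|^n] with [|a_n|], since the odd moments could
    be small through cancellation.  The exponential structure of the
    family excludes this.  With [T n theta = int x^n e^(x theta) beta(dx)],
    separability says that [T_n T_0^n] is a constant multiple of [T_1^n T_0] on
    a neighbourhood of 0.  As [T_n' = T_(n+1)] ([is_derive_tilted_moment]),
    differentiation at 0 gives, for the moments [b_n] of beta,
    [b_1 b_(n+1) = b_n (b_1^2 + n Var)] ([moment_recurrence]), which is the
    recurrence of the moments of a gamma law or of its reflection.  Here [b_1]
    is not 0, for otherwise [b_2 = 0] and beta would be a point mass.  So
    consecutive [|a_n|] have ratios bounded above and below up to a factor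
    [n + 1] ([coefficient_ratio]), and the odd absolute moments are controlled
    by the two neighbouring even ones ([nef_normX_le]). *)

(** * Series under the integral sign *)

(** Term by term integration: the partial sums are dominated by [sum_n |f_n|],
    whose integral is at most [sum_n g_n] by monotone convergence. *)
Lemma integral_series {d} {T : measurableType d} {R : realType}
    (mu : {measure set T -> \bar R}) (D : set T)
    (f : nat -> T -> R) (g : nat -> R) :
  measurable D ->
  (forall n, measurable_fun D (f n)) ->
  (forall n, (\int[mu]_(x in D) `|f n x|%:E <= (g n)%:E)%E) ->
  cvgn (series g) ->
  (forall x, D x -> cvgn [normed series (f^~ x)]) ->
  mu.-integrable D (fun x => (limn (series (f^~ x)))%:E) /\
  series (fun n => \int[mu]_(x in D) f n x) @ \oo -->
    \int[mu]_(x in D) limn (series (f^~ x)).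
Proof.
move=> mD mf fg cg cf.
have g0 n : 0 <= g n.
  by rewrite -lee_fin; apply: le_trans (fg n); exact: integral_ge0.
have intf n : mu.-integrable D (EFin \o f n).
  apply/integrableP; split; first exact/measurable_EFinP.
  by apply: le_lt_trans (fg n) _; rewrite ltry.
pose h x := limn [normed series (f^~ x)].
have hE x : D x -> ((h x)%:E = \sum_(n <oo) `|f n x|%:E)%E.
  move=> Dx; rewrite /h -EFin_lim; last exact: cf.
  by congr (limn _); apply/funext => n /=; rewrite sumEFin.
have mh : measurable_fun D h.
  apply: (@measurable_fun_cvg _ _ _ D
    (fun n x => \sum_(0 <= k < n) `|f k x|)) => [n|x Dx].
    by apply: measurable_sum => k; exact: measurableT_comp.
  exact: cf.
have inth : mu.-integrable D (EFin \o h).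
  apply/integrableP; split; first exact/measurable_EFinP.
  have h0 x : D x -> (0 <= (h x)%:E)%E.
    by move=> Dx; rewrite hE//; apply: nneseries_ge0.
  rewrite (eq_integral (fun x => \sum_(n <oo) `|f n x|%:E)%E); last first.
    by move=> x /set_mem Dx; rewrite gee0_abs ?h0//= hE.
  rewrite integral_nneseries//; last first.
    by move=> n; apply/measurable_EFinP; exact: measurableT_comp.
  apply: (@le_lt_trans _ _ (\sum_(n <oo) (g n)%:E)%E).
    by apply: lee_nneseries => [n _ _|n _]; [exact: integral_ge0|exact: fg].
  rewrite (_ : (\sum_(n <oo) (g n)%:E)%E = (limn (series g))%:E) ?ltry//.
  rewrite -EFin_lim//.
  by congr (limn _); apply/funext => n /=; rewrite sumEFin.
have fl x : D x -> (series (f^~ x) n)%:E @[n --> \oo] -->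
    (limn (series (f^~ x)))%:E.
  by move=> Dx; apply: cvg_EFin; [exact: nearW|exact: normed_cvg (cf x Dx)].
have ms n : measurable_fun D (fun x => (series (f^~ x) n)%:E).
  by apply/measurable_EFinP; exact: measurable_sum.
have ml : measurable_fun D (fun x => (limn (series (f^~ x)))%:E).
  by apply: emeasurable_fun_cvg fl => n; exact: ms.
have bnd : {ae mu, forall x n, D x -> (`|(series (f^~ x) n)%:E| <= (h x)%:E)%E}.
  apply: aeW => x n Dx /=; rewrite lee_fin.
  apply: (le_trans (ler_norm_sum _ _ _)).
  apply: (@nondecreasing_cvgn_le _ [normed series (f^~ x)]); last exact: cf.
  by apply: nondecreasing_series => k _ _; exact: normr_ge0.
have [i1 _ i2] := dominated_convergence mD ms ml (aeW _ fl) inth bnd.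
split => //.
rewrite (_ : series _ = fine \o (fun n =>
    \int[mu]_(x in D) (series (f^~ x) n)%:E)%E); last first.
  apply/funext => n /=; rewrite /series /Rintegral /= sum_fine; last first.
    by move=> k _; apply: integrable_fin_num => //; exact: intf.
  rewrite -integral_sum//; congr fine.
  by apply: eq_integral => x _; rewrite sumEFin.
apply: fine_cvg; rewrite fineK//.
apply: integrable_fin_num => //; exact: i1.
Qed.

(** The n-th derivative of cos at z is [cos (pi n / 2 + z)].  Expanding it
    splits the series into [cos z] times the series of
    [cos y] minus [sin z] times that of [sin y]. *)
Lemma cos_taylor (R : realType) (y z : R) :
  series (fun n => y ^+ n * cos (pi / 2 * n%:R + z) / n`!%:R) @ \oo -->
  cos (y + z).
Proof.
have cosn n : cos (pi / 2 * n%:R) = (~~ odd n)%:R * (-1) ^+ n./2 :> R.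
  elim/ltn_ind: n => -[|[|n]] IH.
  - by rewrite mulr0 cos0 mul1r.
  - by rewrite mulr1 cos_pihalf mul0r.
  - have -> : pi / 2 * n.+2%:R = pi / 2 * n%:R + pi :> R.
      by rewrite -[n.+2]addn2 natrD mulrDr divfK ?pnatr_eq0.
    rewrite cosDpi (IH n (ltnW (ltnSn _))) /=.
    by rewrite negbK exprS mulN1r mulrN.
have sinn n : sin (pi / 2 * n%:R) = (odd n)%:R * (-1) ^+ n.-1./2 :> R.
  elim/ltn_ind: n => -[|[|n]] IH.
  - by rewrite mulr0 sin0 mul0r.
  - by rewrite mulr1 sin_pihalf mul1r.
  - have -> : pi / 2 * n.+2%:R = pi / 2 * n%:R + pi :> R.
      by rewrite -[n.+2]addn2 natrD mulrDr divfK ?pnatr_eq0.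
    rewrite sinDpi (IH n (ltnW (ltnSn _))) /= negbK.
    by case: n {IH} => [|n]; rewrite ?mul0r ?oppr0//= exprS mulN1r mulrN.
rewrite cosD.
have -> : (fun n => y ^+ n * cos (pi / 2 * n%:R + z) / n`!%:R) =
    cos z *: cos_coeff y - sin z *: sin_coeff y.
  apply/funext => n; rewrite cosD cosn sinn !fctE /cos_coeff /sin_coeff /=.
  by rewrite /GRing.scale /= -?exprnP; ring.
rewrite seriesD seriesN !seriesZ.
rewrite (mulrC (cos y)) (mulrC (sin y)).
apply: cvgB; apply: cvgZr.
  by rewrite unlock; exact: is_cvg_series_cos_coeff.
by rewrite unlock; exact: is_cvg_series_sin_coeff.
Qed.

(** * Integration against a density *)

Section density.
Import HBNNSimple.

(** Both sides are limits along an increasing sequence of simple functions, and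
    for an indicator function the equality is the hypothesis on nu. *)
Lemma ge0_integral_density {d} {T : measurableType d} {R : realType}
    (mu nu : {measure set T -> \bar R}) (p : T -> R) (f : T -> \bar R) :
  measurable_fun setT p -> (forall x, 0 <= p x) ->
  (forall A, measurable A -> nu A = (\int[mu]_(x in A) (p x)%:E)%E) ->
  measurable_fun setT f -> (forall x, (0 <= f x)%E) ->
  (\int[nu]_x f x = \int[mu]_x (f x * (p x)%:E))%E.
Proof.
move=> mp p0 nuE mf f0.
have mp' : measurable_fun setT (fun x => (p x)%:E) by exact/measurable_EFinP.
pose h := nnsfun_approx measurableT mf.
have -> : (\int[nu]_x f x = lim (\int[nu]_x (h n x)%:E @[n --> \oo]))%E.
  have fE x : f x = lim ((h n x)%:E @[n --> \oo]).
    by apply/esym/cvg_lim => //; exact: cvg_nnsfun_approx.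
  under eq_integral do rewrite fE.
  apply: monotone_convergence => //.
  - by move=> n; apply/measurable_EFinP.
  - by move=> n x _; rewrite lee_fin.
  - by move=> x _ a b ab; rewrite lee_fin; exact/lefP/nd_nnsfun_approx.
have -> : (\int[mu]_x (f x * (p x)%:E) =
    lim (\int[mu]_x ((h n x)%:E * (p x)%:E) @[n --> \oo]))%E.
  have fE x : (f x * (p x)%:E = lim ((h n x)%:E * (p x)%:E @[n --> \oo]))%E.
    apply/esym/cvg_lim => //; apply: cvgeZr => //.
    exact: cvg_nnsfun_approx.
  under eq_integral do rewrite fE.
  apply: monotone_convergence => //.
  - by move=> n; apply: emeasurable_funM => //; exact/measurable_EFinP.
  - by move=> n x _; rewrite mule_ge0 ?lee_fin.
  - move=> x _ a b ab; rewrite lee_wpmul2r ?lee_fin//.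
    exact/lefP/nd_nnsfun_approx.
suff suf n : (\int[nu]_x (h n x)%:E =
    \int[mu]_x ((h n x)%:E * (p x)%:E))%E.
  by under eq_fun do rewrite suf.
transitivity (\int[nu]_x
   (\sum_(y \in range (h n)) (y * \1_(h n @^-1` [set y]) x)%:E))%E.
  by apply: eq_integral => t tE; rewrite /= fimfunE -fsumEFin.
have mindic r : measurable_fun setT
    (fun x => (r * \1_(h n @^-1` [set r]) x)%:E).
  by apply: (measurable_comp measurableT) => //; exact: measurable_funM.
rewrite ge0_integral_fsum//; last by move=> y x _; exact: nnfun_muleindic_ge0.
transitivity (\int[mu]_x (\sum_(y \in range (h n))
    (y * \1_(h n @^-1` [set y]) x)%:E * (p x)%:E))%E; last first.
  apply: eq_integral => x _.
  rewrite -ge0_mule_fsuml => [|y]; last exact: nnfun_muleindic_ge0.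
  by rewrite fsumEFin // -(fimfunE _ x).
rewrite ge0_integral_fsum//; last 2 first.
  - by move=> y; apply: emeasurable_funM.
  - move=> y x _; apply: mule_ge0; last by rewrite lee_fin.
    exact: nnfun_muleindic_ge0.
apply: eq_fsbigr => r rhn.
under eq_integral do rewrite EFinM.
rewrite integralZl_indic_nnsfun //.
under [RHS]eq_integral do rewrite EFinM -muleA.
rewrite ge0_integralZl//.
- congr (_ * _)%E; under [RHS]eq_integral do rewrite muleC.
  rewrite [RHS](eq_integral ((EFin \o p) \_ (h n @^-1` [set r]))); last first.
    by move=> x xE; rewrite epatch_indic.
  by rewrite -integral_mkcondr setTI integral_indic// setIT nuE.
- by apply: emeasurable_funM => //; exact/measurable_EFinP.
- by move=> t _; rewrite mule_ge0 ?lee_fin.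
- by move: rhn; rewrite inE => -[t _ <-]; rewrite lee_fin.
Qed.

Lemma integral_density {d} {T : measurableType d} {R : realType}
    (mu nu : {measure set T -> \bar R}) (p f : T -> R) :
  measurable_fun setT p -> (forall x, 0 <= p x) ->
  (forall A, measurable A -> nu A = (\int[mu]_(x in A) (p x)%:E)%E) ->
  measurable_fun setT f ->
  mu.-integrable setT (fun x => (f x * p x)%:E) ->
  nu.-integrable setT (EFin \o f) /\
  \int[nu]_x f x = \int[mu]_x (f x * p x).
Proof.
move=> mp p0 nuE mf; set fp := (X in mu.-integrable _ X) => ifp.
have mf' : measurable_fun setT (EFin \o f) by exact/measurable_EFinP.
have posM x : (((EFin \o f)^\+ x) * (p x)%:E = fp^\+ x)%E.
  by rewrite !funeposE /= /fp -!EFin_max -EFinM maxr_pMl// mul0r.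
have negM x : (((EFin \o f)^\- x) * (p x)%:E = fp^\- x)%E.
  by rewrite !funenegE /= /fp -!EFin_max -EFinM maxr_pMl// mul0r mulNr.
split.
  apply/integrableP; split => //.
  rewrite (ge0_integral_density mu nu p)//.
  - have /integrableP[_] := ifp; congr (_ < _)%E; apply: eq_integral => x _.
    by rewrite /fp /= normrM (ger0_norm (p0 x)) EFinM.
  - exact: measurableT_comp.
rewrite /Rintegral; congr fine; rewrite integralE [RHS]integralE.
congr (_ - _)%E.
- rewrite (ge0_integral_density mu nu p)//.
  + by apply: eq_integral => x _; rewrite posM.
  + exact: measurable_funepos.
- rewrite (ge0_integral_density mu nu p)//.
  + by apply: eq_integral => x _; rewrite negM.
  + exact: measurable_funeneg.
Qed.

End density.

(** * Tilted moments and their derivatives *)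

Section exponential_moments.
Context {R : realType} (beta : probability (measurableTypeR R) R).

Definition tilted_moment (n : nat) (theta : R) : R :=
  \int[beta]_x (x ^+ n * expR (x * theta)).

(** The polynomial factor is absorbed by an arbitrarily small shift of theta:
    [(delta |x|)^n / n! <= e^(delta |x|)]. *)
Lemma normX_expR_le (n : nat) (theta delta x : R) : 0 < delta ->
  `|x| ^+ n * expR (x * theta) <= n`!%:R / delta ^+ n *
     (expR (x * (theta + delta)) + expR (x * (theta - delta))).
Proof.
move=> d0.
have key y : 0 <= y -> y ^+ n <= n`!%:R * expR y.
  case: n => [|n] y0.
    by rewrite expr0 mul1r -expR0 ler_expR.
  have := expR_ge1Dxn n y0.
  have f0 : 0 < (n.+1)`!%:R :> R by rewrite ltr0n fact_gt0.
  move=> H; rewrite mulrC -ler_pdivrMr//.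
  by apply: le_trans H; rewrite lerDr.
have xd : `|x| ^+ n <= n`!%:R / delta ^+ n * expR (delta * `|x|).
  rewrite mulrAC ler_pdivlMr ?exprn_gt0// -exprMn mulrC.
  by apply: key; rewrite mulr_ge0// ltW.
apply: (@le_trans _ _
  (n`!%:R / delta ^+ n * (expR (delta * `|x|) * expR (x * theta)))).
  by rewrite mulrA ler_wpM2r// expR_ge0.
rewrite ler_wpM2l ?divr_ge0 ?ler0n ?exprn_ge0 ?(ltW d0)//.
rewrite -expRD; have [x0|x0] := ler0P x.
  rewrite (_ : _ + _ = x * (theta - delta)); last ring.
  by rewrite lerDr expR_ge0.
rewrite (_ : _ + _ = x * (theta + delta)); last ring.
by rewrite lerDl expR_ge0.
Qed.

Lemma natural_parameter_near {theta : R} : natural_parameter beta theta ->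
  exists2 delta : R, 0 < delta & forall theta', `|theta' - theta| <= delta ->
    natural_parameter beta theta'.
Proof.
move=> ntheta.
have /nbhs_ballP[e /= e0 He] : nbhs theta (natural_parameter beta).
  exact: open_nbhs_nbhs (conj (open_interior _) ntheta).
exists (e / 2); first by rewrite divr_gt0.
move=> t' ht'; apply: He; rewrite /ball /= distrC.
by apply: le_lt_trans ht' _; rewrite ltr_pdivrMr// ltr_pMr// ltr1n.
Qed.

Lemma measurable_expRM (theta : R) :
  measurable_fun setT (fun x : R => expR (x * theta)).
Proof.
by apply: measurableT_comp; [exact: measurable_expR|exact: mulrr_measurable].
Qed.

Lemma integrable_expR {theta : R} : natural_parameter beta theta ->
  beta.-integrable setT (fun x => (expR (x * theta))%:E).
Proof.
move=> /interior_subset h; apply/integrableP; split.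
  by apply/measurable_EFinP; exact: measurable_expRM.
by under eq_integral do rewrite gee0_abs ?lee_fin ?expR_ge0//.
Qed.

Lemma integrable_normX_expR (n : nat) {theta : R} :
  natural_parameter beta theta ->
  beta.-integrable setT (fun x => (`|x| ^+ n * expR (x * theta))%:E).
Proof.
move=> /natural_parameter_near[d d0 hd].
have i1 : beta.-integrable setT (fun x => (expR (x * (theta + d)))%:E).
  by apply/integrable_expR/hd; rewrite addrC addKr ger0_norm// ltW.
have i2 : beta.-integrable setT (fun x => (expR (x * (theta - d)))%:E).
  by apply/integrable_expR/hd; rewrite addrC addKr normrN ger0_norm// ltW.
have := integrableZl measurableT (n`!%:R / d ^+ n)
  (integrableD measurableT i1 i2).
apply: le_integrable => //.
  apply/measurable_EFinP; apply: measurable_funM.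
    by apply: measurable_funX; exact: normr_measurable.
  exact: measurable_expRM.
move=> x _; rewrite -EFinD -EFinM !gee0_abs.
- by rewrite lee_fin normX_expR_le.
- by rewrite lee_fin mulr_ge0 ?divr_ge0 ?addr_ge0 ?expR_ge0 ?exprn_ge0// ltW.
- by rewrite lee_fin mulr_ge0 ?expR_ge0 ?exprn_ge0.
Qed.

Lemma integrableX_expR (n : nat) {theta : R} :
  natural_parameter beta theta ->
  beta.-integrable setT (fun x => (x ^+ n * expR (x * theta))%:E).
Proof.
move=> /(integrable_normX_expR n); apply: le_integrable => //.
  apply/measurable_EFinP; apply: measurable_funM; first exact: measurable_funX.
  exact: measurable_expRM.
by move=> x _; rewrite !abse_EFin lee_fin !normrM !normrX normr_id.
Qed.

(** Differentiation under the integral sign.  On the interval of radius d around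
    theta, the absolute value of the derivative [x^(n+1) e^(x t)] is at most the
    sum of its values at the two endpoints. *)
Lemma is_derive_tilted_moment (n : nat) (theta : R) :
  natural_parameter beta theta ->
  is_derive theta 1 (tilted_moment n) (tilted_moment n.+1 theta).
Proof.
move=> ntheta; have [d d0 hd] := natural_parameter_near ntheta.
have nD : natural_parameter beta (theta + d).
  by apply: hd; rewrite addrC addKr ger0_norm// ltW.
have nB : natural_parameter beta (theta - d).
  by apply: hd; rewrite addrC addKr normrN ger0_norm// ltW.
pose f t (x : R) := x ^+ n * expR (x * t).
pose G (x : R) : R :=
  `|x| ^+ n.+1 * expR (x * (theta + d)) + `|x| ^+ n.+1 * expR (x * (theta - d)).
pose I : set R := `]theta - d, theta + d[%classic.
have Itheta : I theta by rewrite /I /= in_itv /=; apply/andP; split; lra.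
have In t : I t -> natural_parameter beta t.
  by rewrite /I /= in_itv /= => /andP[? ?]; apply: hd; rewrite ler_norml; lra.
have df (t x : R) : is_derive t 1 (f ^~ x) (x ^+ n.+1 * expR (x * t)).
  rewrite /f; apply: is_derive_eq.
  by rewrite /GRing.scale /= exprS; ring.
have intf t : I t -> beta.-integrable setT (EFin \o f t).
  by move=> /In nt; exact: integrableX_expR.
have derf t x : I t -> setT x -> derivable (f ^~ x) t 1 by [].
have G0 x : 0 <= G x.
  by rewrite addr_ge0// mulr_ge0 ?exprn_ge0// expR_ge0.
have intG : beta.-integrable setT (EFin \o G).
  exact: (integrableD measurableT (integrable_normX_expR n.+1 nD)
    (integrable_normX_expR n.+1 nB)).
have Gub t x : I t -> setT x -> `|partial1of2 f t x| <= G x.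
  rewrite /I /= in_itv /= => /andP[t1 t2] _.
  rewrite /partial1of2 derive1E derive_val normrM normrX /G -mulrDr.
  rewrite ler_wpM2l ?exprn_ge0// ger0_norm ?expR_ge0//.
  have [x0|x0] := ler0P x.
    apply: (@le_trans _ _ (expR (x * (theta - d)))).
      by rewrite ler_expR ler_wnM2l// ltW.
    by rewrite lerDr expR_ge0.
  apply: (@le_trans _ _ (expR (x * (theta + d)))).
    by rewrite ler_expR ler_wpM2l// ltW.
  by rewrite lerDl expR_ge0.
have D := derivable_under_integral measurableT Itheta intf derf G0 intG Gub.
apply: DeriveDef; first exact: D.
have := differentiation_under_integral measurableT Itheta intf derf G0 intG Gub.
rewrite derive1E => ->; apply: eq_Rintegral => x _.
by rewrite /partial1of2 derive1E derive_val.
Qed.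

End exponential_moments.

(** * Moments of the members of the family *)

Section nef_moments.
Context {R : realType} (beta : probability (measurableTypeR R) R).
Local Notation tilted_moment := (tilted_moment beta).

Lemma tilted_moment0E (theta : R) :
  tilted_moment 0 theta = fine (laplace beta theta).
Proof.
by congr fine; apply: eq_integral => x _; rewrite expr0 mul1r.
Qed.

(** If the Laplace transform vanished, so would its positive integrand almost
    everywhere, and beta would be the zero measure. *)
Lemma tilted_moment0_gt0 {theta : R} : natural_parameter beta theta ->
  0 < tilted_moment 0 theta.
Proof.
move=> ntheta; rewrite tilted_moment0E.
have Lfin := interior_subset ntheta.
have L0 : (0 <= laplace beta theta)%E.
  by apply: integral_ge0 => x _; rewrite lee_fin expR_ge0.
rewrite fine_gt0// Lfin andbT lt_neqAle L0 andbT eq_sym; apply/eqP => Le.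
have me : measurable_fun setT
    (fun x : measurableTypeR R => (expR (x * theta))%:E).
  by apply/measurable_EFinP; exact: measurable_expRM.
have [H _] := ae_eq_integral_abs beta measurableT me.
have /H : (\int[beta]_x `|(expR (x * theta))%:E| = 0)%E.
  rewrite -[RHS]Le; apply: eq_integral => x _.
  by rewrite gee0_abs ?lee_fin ?expR_ge0.
move=> [N [mN N0 sN]].
have : beta setT = 0%E.
  apply/eqP; rewrite -measure_le0 -N0; apply: le_measure; rewrite ?inE//.
  move=> x _; apply: sN => /= /(_ I) /eqP.
  by rewrite eqe expR_eq0.
by rewrite probability_setT => -[] /eqP; rewrite oner_eq0.
Qed.

Lemma nef_densityE {theta : R} (x : R) : natural_parameter beta theta ->
  nef_density beta theta x = expR (x * theta) / tilted_moment 0 theta.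
Proof.
move=> ntheta; rewrite /nef_density -tilted_moment0E expRB (mulrC theta) lnK//.
by rewrite posrE tilted_moment0_gt0.
Qed.

Lemma nef_integral {theta : R} (f : R -> R) : natural_parameter beta theta ->
  measurable_fun setT f ->
  beta.-integrable setT (fun x => (f x * expR (x * theta))%:E) ->
  (nef beta theta).-integrable setT (EFin \o f) /\
  \int[nef beta theta]_x f x =
    (\int[beta]_x (f x * expR (x * theta))) / tilted_moment 0 theta.
Proof.
move=> ntheta mf intf; pose L := tilted_moment 0 theta.
have densE : (fun x => f x * nef_density beta theta x) =
    (fun x => f x * expR (x * theta) * L^-1).
  by apply/funext => x; rewrite nef_densityE// mulrA.
have intd : beta.-integrable setT
    (fun x => (f x * nef_density beta theta x)%:E).
  rewrite (_ : (fun x => _) =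
      (fun x => (f x * expR (x * theta))%:E) \* cst L^-1%:E)%E.
    exact: integrableZr.
  by apply/funext => x; rewrite nef_densityE// mulrA EFinM.
have [] := integral_density beta (nef beta theta)
  (nef_density beta theta) f (measurable_nef_density beta theta) _ _ mf intd.
- by move=> x; exact: expR_ge0.
- by move=> A mA.
- by move=> i ->; split => //; rewrite densE RintegralZr.
Qed.

Lemma nef_integrable_normX {theta : R} (n : nat) :
  natural_parameter beta theta ->
  (nef beta theta).-integrable setT (fun x => (`|x| ^+ n)%:E).
Proof.
move=> ntheta; have [] // := nef_integral (fun x => `|x| ^+ n) ntheta.
- by apply: measurable_funX; exact: normr_measurable.
- exact: integrable_normX_expR.
Qed.

Lemma nef_momentE {theta : R} (n : nat) : natural_parameter beta theta ->
  (nef beta theta).-integrable setT (fun x => (x ^+ n)%:E) /\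
  moment beta n theta = tilted_moment n theta / tilted_moment 0 theta.
Proof.
move=> ntheta; have [] // := nef_integral (fun x => x ^+ n) ntheta.
exact: integrableX_expR.
Qed.
End nef_moments.

(** * The moment recurrence of a separable family *)

Section separable_ratio.
Context {R : realType} {beta : probability (measurableTypeR R) R}.
Context {zeta xi : R -> R} {a : nat -> R}.
Hypothesis nparam0 : natural_parameter beta 0.
Hypothesis nondegenerate : not_concentrated_on_one_point beta.
Hypothesis a_neq0 : forall n, a n != 0.
Hypothesis moment_factor : forall n theta, natural_parameter beta theta ->
  moment beta n theta = xi theta ^+ n * zeta theta * a n.
Local Notation T := (tilted_moment beta).
Local Notation b n := (T n%N 0).

Lemma momentE0 n : b n = \int[beta]_x (x ^+ n).
Proof. by apply: eq_Rintegral => x _; rewrite mulr0 expR0 mulr1. Qed.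

Lemma moment0_0 : b 0 = 1.
Proof.
rewrite momentE0 (@eq_Rintegral _ _ _ _ _ (cst 1)); last first.
  by move=> x _; rewrite expr0.
rewrite Rintegral_cst// mul1r; exact: (congr1 fine (probability_setT beta)).
Qed.

Lemma integrableX (n : nat) : beta.-integrable setT (fun x => (x ^+ n)%:E).
Proof.
have := integrableX_expR beta n nparam0.
by apply: eq_integrable => // x _; rewrite mulr0 expR0 mulr1.
Qed.

(** A vanishing second moment concentrates beta on 0. *)
Lemma moment2_neq0 : b 2 != 0.
Proof.
apply/eqP; rewrite momentE0 => b2; apply: nondegenerate; exists 0.
have mX : measurable_fun setT (fun x : measurableTypeR R => (x ^+ 2)%:E).
  by case/integrableP: (integrableX 2).
have [H _] := ae_eq_integral_abs beta measurableT mX.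
have /H : (\int[beta]_x `|(x ^+ 2)%:E| = 0)%E.
  rewrite (eq_integral (fun x : measurableTypeR R => (x ^+ 2)%:E)); last first.
    by move=> x _; rewrite gee0_abs// lee_fin sqr_ge0.
  rewrite -[LHS]fineK; last first.
    exact: (integrable_fin_num measurableT (integrableX 2)).
  by rewrite [fine _]b2.
move=> [N [mN N0 sN]].
apply/eqP; rewrite -measure_le0 -N0; apply: le_measure; rewrite ?inE//.
  exact: measurableC.
move=> x xn0; apply: sN => /= /(_ I) /eqP.
by rewrite eqe sqrf_eq0 => /eqP.
Qed.

Lemma variance_ge0 : 0 <= b 2 - b 1 ^+ 2.
Proof.
have m (n : nat) : beta.-integrable setT (EFin \o (fun x => x ^+ n : R)).
  exact: integrableX.
have i1 : beta.-integrable setT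
    (EFin \o (fun x => (- (2 * b 1)) * (x ^+ 1 : R))).
  exact: (integrableZl measurableT (- (2 * b 1)) (integrableX 1)).
have i0 : beta.-integrable setT (EFin \o (fun x => b 1 ^+ 2 * (x ^+ 0 : R))).
  exact: (integrableZl measurableT (b 1 ^+ 2) (integrableX 0)).
have i10 : beta.-integrable setT
    (EFin \o (fun x => (- (2 * b 1)) * (x ^+ 1 : R) +
      b 1 ^+ 2 * (x ^+ 0 : R))).
  exact: (integrableD measurableT i1 i0).
have : 0 <= \int[beta]_x ((x : R) ^+ 2 +
    ((- (2 * b 1)) * x ^+ 1 + b 1 ^+ 2 * x ^+ 0)).
  apply: Rintegral_ge0 => x _.
  rewrite (_ : _ + _ = (x - b 1) ^+ 2) ?sqr_ge0//; ring.
rewrite (RintegralD measurableT (m 2%N) i10) (RintegralD measurableT i1 i0).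
rewrite (RintegralZl _ measurableT (m 1%N)) (RintegralZl _ measurableT (m 0%N)).
rewrite -!momentE0 moment0_0.
by congr (_ <= _); ring.
Qed.

(** The moment of order 0 is the total mass of a probability measure, so [zeta]
    is constant on the natural parameter set. *)
Lemma zeta_a0 {theta} : natural_parameter beta theta ->
  zeta theta * a 0 = 1.
Proof.
move=> nt; have := moment_factor 0 theta nt.
have [_ ->] := nef_momentE beta 0 nt.
by rewrite divff ?gt_eqF ?tilted_moment0_gt0// expr0 mul1r.
Qed.

Lemma tilted_factor n {theta} : natural_parameter beta theta ->
  T n theta = xi theta ^+ n * zeta theta * a n * T 0 theta.
Proof.
move=> nt; rewrite -moment_factor//.
have [_ ->] := nef_momentE beta n nt.
by rewrite divfK// gt_eqF ?tilted_moment0_gt0.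
Qed.

(** If [b_1] vanished then so would [xi 0], as [zeta 0 * a 1] is not 0, and
    with it [b_2]. *)
Lemma moment1_neq0 : b 1 != 0.
Proof.
apply: contraNneq moment2_neq0.
rewrite (tilted_factor 1)// (tilted_factor 2)// moment0_0 => /eqP.
have z0 : zeta 0 != 0.
  apply/eqP => z0; move/eqP: (zeta_a0 nparam0).
  by rewrite z0 mul0r eq_sym oner_eq0.
rewrite !mulf_eq0 (negPf z0) !(negPf (a_neq0 _)) oner_eq0 !orbF expr1 => /eqP->.
by rewrite eqxx.
Qed.

(** Eliminating [zeta] by [zeta_a0] and [xi] by the moment of order 1 turns
    separability into a relation between the functions [T n] alone.  It is
    written with products only, so that it can be differentiated. *)
Lemma tilted_proportional n {theta} : natural_parameter beta theta ->
  T n theta * T 0 theta ^+ n =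
  a n / a 0 * (a 0 / a 1) ^+ n * (T 1 theta ^+ n * T 0 theta).
Proof.
move=> nt; rewrite (tilted_factor n)// (tilted_factor 1)//.
have -> : zeta theta = (a 0)^-1.
  by apply: (mulIf (a_neq0 0)); rewrite zeta_a0// mulVf.
rewrite expr1 !exprMn !exprVn.
have h0 := a_neq0 0; have h1 : a 1 ^+ n != 0 by rewrite expf_neq0.
have h0n : a 0 ^+ n != 0 by rewrite expf_neq0.
by field; apply/and3P.
Qed.

(** Derivative at 0 of [tilted_proportional], multiplied by [b 1]. *)
Lemma moment_recurrence n :
  b 1 * b n.+1 = b n * (b 1 ^+ 2 + n%:R * (b 2 - b 1 ^+ 2)).
Proof.
have d (k : nat) : is_derive (0 : R) 1 (T k) (T k.+1 0).
  exact: is_derive_tilted_moment.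
set c := a n / a 0 * (a 0 / a 1) ^+ n.
have bn : b n = c * b 1 ^+ n.
  have := tilted_proportional n nparam0.
  by rewrite moment0_0 expr1n !mulr1.
have near0 : \forall t \near (0 : R),
    (T n * T 0 ^+ n) t = (cst c * (T 1 ^+ n * T 0)) t.
  have : nbhs (0 : R) (natural_parameter beta).
    exact: open_nbhs_nbhs (conj (open_interior _) nparam0).
  apply: filterS => t nt; rewrite !fctE.
  exact: tilted_proportional.
have dX k : is_derive (0 : R) 1 (T k ^+ n)
    ((n%:R * T k 0 ^+ n.-1) *: T k.+1 0) by exact: is_deriveX.
have [_ D1] := near_eq_is_derive near0
  (@is_deriveM _ _ _ _ _ _ _ _ (d n) (dX 0%N)).
have [_ D2] := @is_deriveM _ _ _ _ _ _ _ _ (is_derive_cst c (0 : R) 1)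
  (@is_deriveM _ _ _ _ _ _ _ _ (dX 1%N) (d 0%N)).
have pn : n%:R * b 1 ^+ n.-1 * b 1 = n%:R * b 1 ^+ n.
  by case: n {c bn near0 dX D1 D2} => [|n]; rewrite ?mul0r// -mulrA -exprSr.
have T0n k : (T k ^+ n) 0 = b k ^+ n by rewrite exprfctE.
move: D1; rewrite D2 /GRing.scale /= !T0n moment0_0 !expr1n bn => E.
have -> : b n.+1 = c * (b 1 ^+ n * b 1 + n%:R * b 1 ^+ n.-1 * b 2)
    - c * b 1 ^+ n * (n%:R * b 1).
  by move: E; rewrite mulr0 addr0 !mulr1 !mul1r => ->; ring.
rewrite (_ : b 1 * _ = c * (b 1 ^+ n * b 1 ^+ 2
   + n%:R * b 1 ^+ n.-1 * b 1 * b 2 - n%:R * b 1 ^+ n * b 1 ^+ 2)); last ring.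
by rewrite pn; ring.
Qed.

Lemma xi0_neq0 : xi 0 != 0.
Proof.
apply: contraNneq moment1_neq0 => x0.
by rewrite tilted_factor// x0 expr1 !mul0r.
Qed.

(** The factor [b_1^2 + n Var] of [moment_recurrence] lies between [b_1^2],
    since the variance is nonnegative, and [(n + 1) b_2]. *)
Lemma coefficient_ratio : exists2 C : R, 1 <= C & forall n,
  `|a n| <= C * `|a n.+1| /\ `|a n.+1| <= C * n.+1%:R * `|a n|.
Proof.
have b1 := moment1_neq0; have v0 := variance_ge0.
have x0 := xi0_neq0.
have z0 : zeta 0 != 0.
  apply/eqP => z0; move/eqP: (zeta_a0 nparam0).
  by rewrite z0 mul0r eq_sym oner_eq0.
have q0 : 0 < b 1 ^+ 2 by rewrite lt_neqAle sqr_ge0 eq_sym sqrf_eq0 b1.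
pose p : R := `|xi 0 * b 1|.
have p0 : 0 < p by rewrite normr_gt0 mulf_neq0.
have b20 : 0 <= b 2 by apply: le_trans (ltW q0) _; rewrite -subr_ge0.
have C1 : 0 <= p / b 1 ^+ 2 by rewrite divr_ge0// ltW.
have C2 : 0 <= b 2 / p by rewrite divr_ge0// ltW.
exists (1 + p / b 1 ^+ 2 + b 2 / p) => [|n]; first by lra.
pose w := b 1 ^+ 2 + n%:R * (b 2 - b 1 ^+ 2).
have n0 : 0 <= n%:R :> R by [].
have w1 : b 1 ^+ 2 <= w by rewrite lerDl mulr_ge0.
have w2 : w <= n.+1%:R * b 2.
  rewrite /w -natr1; have : n%:R * (b 2 - b 1 ^+ 2) <= n%:R * b 2.
    by rewrite ler_wpM2l// lerBlDr lerDl ltW.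
  by lra.
have E : p * `|a n.+1| = `|a n| * w.
  rewrite /p -normrM -[w]ger0_norm ?(le_trans (ltW q0))// -normrM; congr `|_|.
  have := moment_recurrence n; rewrite -/w.
  rewrite (tilted_factor n)// (tilted_factor n.+1)// moment0_0 => H.
  have k0 : xi 0 ^+ n * zeta 0 != 0 by rewrite mulf_neq0// expf_neq0.
  apply: (mulfI k0).
  transitivity (b 1 * (xi 0 ^+ n.+1 * zeta 0 * a n.+1 * 1)).
    by rewrite exprS; ring.
  by rewrite H; ring.
split.
  apply: (@le_trans _ _ (p / b 1 ^+ 2 * `|a n.+1|)); last first.
    by rewrite ler_wpM2r//; lra.
  by rewrite mulrAC ler_pdivlMr// E ler_wpM2l.
apply: (@le_trans _ _ (b 2 / p * n.+1%:R * `|a n|)); last first.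
  by rewrite !ler_wpM2r//; lra.
rewrite -(ler_pM2l p0) E mulrC.
have -> : p * (b 2 / p * n.+1%:R * `|a n|) = n.+1%:R * b 2 * `|a n|.
  by field; rewrite gt_eqF.
by rewrite ler_wpM2r.
Qed.

(** The bound that makes the kernel integrable.  For even n the absolute moment
    is a moment.  For odd n, [|x|^n <= |x|^(n-1) + |x|^(n+1)] reduces it to even
    ones, and [coefficient_ratio] brings [a_(n-1)] and [a_(n+1)] back to [a_n];
    the factor [n + 1] which this costs is absorbed by [n + 1 <= 2^n]. *)
Lemma nef_normX_le {theta : R} : natural_parameter beta theta ->
  exists D r : R, [/\ 0 <= D, 0 <= r & forall n,
    \int[nef beta theta]_x (`|x| ^+ n) <= D * r ^+ n * `|a n|].
Proof.
move=> nt; have [C C1 HC] := coefficient_ratio.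
have C0 : 0 <= C by apply: le_trans C1.
pose A n := \int[nef beta theta]_x (`|x| ^+ n).
pose r : R := 1 + `|xi theta|; pose z : R := `|zeta theta|.
have r0 : 0 <= r by rewrite /r addr_ge0.
have r1 : 1 <= r by rewrite /r lerDl.
have z0 : 0 <= z by rewrite /z.
have even n : ~~ odd n -> A n <= z * r ^+ n * `|a n|.
  move=> en; have -> : A n = moment beta n theta.
    apply: eq_Rintegral => x _; rewrite -normrX ger0_norm//.
    by rewrite exprn_even_ge0.
  rewrite moment_factor//; apply: (le_trans (ler_norm _)).
  rewrite !normrM normrX -/z (mulrC _ z) ler_wpM2r// ler_wpM2l//.
  by rewrite lerXn2r ?nnegrE// /r lerDr.
exists (2 * z * C * r), (2 * r); split; rewrite ?mulr_ge0// => n.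
have n2 : n.+1%:R <= 2 ^+ n :> R by rewrite -natrX ler_nat ltn_expl.
have bound : A n <= 2 * z * C * n.+1%:R * r ^+ n.+1 * `|a n|.
  have [on|en] := boolP (odd n); last first.
    apply: (le_trans (even n en)); rewrite ler_wpM2r//.
    have h : 1 <= n.+1%:R :> R by rewrite ler1n.
    have h' : 1 <= C * n.+1%:R by rewrite mulr_ege1.
    have rn : r ^+ n <= r ^+ n.+1 by rewrite ler_weXn2l.
    have rn0 : 0 <= r ^+ n by rewrite exprn_ge0.
    apply: (@le_trans _ _ (z * (C * n.+1%:R) * r ^+ n.+1)); last first.
      rewrite ler_wpM2r ?exprn_ge0// -!mulrA (mulrC 2) -!mulrA.
      rewrite ler_wpM2l// ler_wpM2l//; lra.
    rewrite ler_pM ?mulr_ge0//.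
    by rewrite ler_peMr.
  case: n on n2 => // k; rewrite [odd _]/= => ek n2.
  have le1 : A k.+1 <= A k + A k.+2.
    rewrite /A -RintegralD//; [|exact: nef_integrable_normX..].
    apply: le_Rintegral => //; first exact: nef_integrable_normX.
      exact: (integrableD measurableT (nef_integrable_normX beta k nt)
        (nef_integrable_normX beta k.+2 nt)).
    move=> x _; have [x1|x1] := lerP `|x| 1.
      apply: (@le_trans _ _ (`|x| ^+ k)); last by rewrite lerDl exprn_ge0.
      by rewrite ler_wiXn2l.
    apply: (@le_trans _ _ (`|x| ^+ k.+2)); last by rewrite lerDr exprn_ge0.
    by rewrite ler_weXn2l// ltW.
  have Ak := even k ek; have Ak2 := even k.+2.
  rewrite /= negbK in Ak2; have {}Ak2 := Ak2 ek.
  have [Hk _] := HC k; have [_ Hk2] := HC k.+1.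
  apply: (le_trans le1).
  have h : 1 <= k.+2%:R :> R by rewrite ler1n.
  have rk : r ^+ k <= r ^+ k.+2 by rewrite ler_weXn2l// ltnW.
  have B1 : A k <= z * C * k.+2%:R * r ^+ k.+2 * `|a k.+1|.
    apply: (le_trans Ak).
    apply: (@le_trans _ _ (z * r ^+ k.+2 * (C * `|a k.+1|))).
      by rewrite ler_pM ?mulr_ge0 ?exprn_ge0// ler_wpM2l.
    rewrite (_ : _ * _ = (z * C * r ^+ k.+2 * `|a k.+1|) * 1); last ring.
    rewrite [leRHS](_ : _ = (z * C * r ^+ k.+2 * `|a k.+1|) * k.+2%:R);
      last ring.
    rewrite ler_wpM2l//.
    apply: mulr_ge0 => //; apply: mulr_ge0; first exact: mulr_ge0.
    exact: exprn_ge0.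
  have B2 : A k.+2 <= z * C * k.+2%:R * r ^+ k.+2 * `|a k.+1|.
    apply: (le_trans Ak2).
    apply: (@le_trans _ _ (z * r ^+ k.+2 * (C * k.+2%:R * `|a k.+1|))).
      by rewrite ler_wpM2l// mulr_ge0// exprn_ge0.
    by rewrite le_eqVlt; apply/orP; left; apply/eqP; ring.
  apply: (le_trans (lerD B1 B2)).
  by rewrite le_eqVlt; apply/orP; left; apply/eqP; ring.
apply: (le_trans bound); rewrite ler_wpM2r// exprMn.
rewrite [leLHS](_ : _ = 2 * z * C * r * r ^+ n * n.+1%:R); last first.
  by rewrite exprS; ring.
rewrite mulrA -!mulrA (mulrC (2 ^+ n)) !mulrA ler_wpM2l//.
by rewrite !mulr_ge0 ?exprn_ge0//.
Qed.

End separable_ratio.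

(** * The kernel as a power series, and its mean *)

Section bounded_functions.
Context {R : realType}.
Local Notation mu := (@lebesgue_measure R).
Local Notation D := (`[(-1 : R), 1]%classic : set R).

Definition bounded_measurable (f : R -> R) :=
  measurable_fun D f /\ exists M, forall s, s \in `[-1, 1] -> `|f s| <= M.

Lemma bounded_measurable_integrable {f : R -> R} : bounded_measurable f ->
  mu.-integrable D (EFin \o f).
Proof.
move=> [mf [M fM]]; apply: measurable_bounded_integrable => //.
  rewrite /= lebesgue_measure_itv.
  by case: ifP => _; rewrite ?ltry// -EFinB ltry.
exists M; split; first exact: num_real.
by move=> x Mx s /= Ds; apply: le_trans (ltW Mx); exact: fM.
Qed.

Lemma admissible_bounded_measurable {omega : R -> R} : admissible omega ->
  bounded_measurable omega.
Proof.
case=> mo o0 [M oM] _; split => //; exists M => s Ds.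
by rewrite ger0_norm ?oM ?o0.
Qed.

End bounded_functions.

Section weighted_series.
Context {R : realType} {omega : R -> R}.
Hypothesis adm : admissible omega.
Local Notation mu := (@lebesgue_measure R).
Local Notation D := (`[(-1 : R), 1]%classic : set R).

(** An admissible weight has mass 1 on [-1, 1], so a pointwise bound on the
    terms is also a bound on their weighted integrals, and [integral_series]
    applies. *)
Lemma integral_weighted_series (h : nat -> R -> R) (B : nat -> R) :
  (forall n, measurable_fun setT (h n)) ->
  (forall n s, s \in `[-1, 1] -> `|h n s| <= B n) ->
  cvgn (series B) ->
  [/\ forall n, mu.-integrable D (EFin \o (fun s => h n s * omega s)),
      forall n, `|\int[mu]_(s in D) (h n s * omega s)| <= B n,
      mu.-integrable D (fun s => (limn (series (h^~ s)) * omega s)%:E) &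
      series (fun n => \int[mu]_(s in D) (h n s * omega s)) @ \oo -->
        \int[mu]_(s in D) (limn (series (h^~ s)) * omega s)].
Proof.
move=> mh hB cB.
have io := bounded_measurable_integrable (admissible_bounded_measurable adm).
have mD : measurable (D : set (measurableTypeR R)) by exact: measurable_itv.
have o0 s : D s -> 0 <= omega s by move=> Ds; apply: (admissible_ge0 adm).
have mo := admissible_measurable adm.
have mho n : measurable_fun D (fun s => h n s * omega s).
  by apply: measurable_funM => //; exact: measurable_funTS.
have B0 n : 0 <= B n.
  by apply: le_trans (hB n 0 _); rewrite ?normr_ge0// in_itv /= oppr_le0 !ler01.
have hoB n s : D s -> `|h n s * omega s| <= B n * omega s.
  by move=> Ds; rewrite normrM (ger0_norm (o0 _ Ds)) ler_wpM2r ?o0// hB.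
have iBo n : mu.-integrable D (EFin \o (fun s => B n * omega s)).
  exact: (integrableZl mD (B n) io).
have iho n : mu.-integrable D (EFin \o (fun s => h n s * omega s)).
  apply: le_integrable (iBo n) => //.
    by apply/measurable_EFinP; exact: mho.
  move=> s Ds /=; rewrite lee_fin; apply: (le_trans (hoB _ _ Ds)).
  exact: ler_norm.
have iB n : \int[mu]_(s in D) (B n * omega s) = B n.
  by rewrite RintegralZl// (admissible_integral adm) mulr1.
have bound n : (\int[mu]_(s in D) `|h n s * omega s|%:E <= (B n)%:E)%E.
  rewrite -{1}(iB n) /Rintegral fineK; last first.
    exact: (integrable_fin_num mD (iBo n)).
  apply: ge0_le_integral => //.
  - by apply/measurable_EFinP; apply: measurableT_comp => //; exact: mho.
  - by apply/measurable_EFinP; exact: measurable_funM.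
  - by move=> s Ds; rewrite lee_fin hoB.
have cn s : D s -> cvgn [normed series (h^~ s)].
  move=> Ds; apply: (@series_le_cvg _ _ B) cB => // n.
    exact: normr_ge0.
  exact: hB.
have lim s : D s -> limn (series (fun n => h n s * omega s)) =
    limn (series (h^~ s)) * omega s.
  move=> Ds; rewrite mulrC.
  have -> : (fun n => h n s * omega s) = omega s *: (h^~ s).
    by apply/funext => n; rewrite fctE /= mulrC.
  by rewrite lim_seriesZ//; exact: normed_cvg (cn s Ds).
have [] := integral_series mu D (fun n s => h n s * omega s) B
  mD mho bound cB.
  move=> s Ds; apply: (@series_le_cvg _ _ (omega s *: B)).
  - by move=> n; exact: normr_ge0.
  - by move=> n; rewrite mulr_ge0 ?o0.
  - by move=> n; rewrite /= fctE /GRing.scale /= (mulrC _ (B n)) hoB.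
  - exact: is_cvg_seriesZ.
move=> H1 H2; split; first exact: iho.
- move=> n; apply: (le_trans (le_normr_Rintegral mD (iho n))).
  rewrite -[leRHS]/(fine (B n)%:E) fine_le//.
  rewrite ge0_fin_numE; last exact: integral_ge0.
  by apply: le_lt_trans (bound n) _; rewrite ltry.
- by apply: eq_integrable H1 => // s /set_mem Ds; rewrite lim.
- suff -> : \int[mu]_(s in D) (limn (series (h^~ s)) * omega s) =
      \int[mu]_(s in D) limn (series (fun n => h n s * omega s)) by exact: H2.
  by apply: eq_Rintegral => s /set_mem Ds; rewrite lim.
Qed.

End weighted_series.

Section kernel.
Context {R : realType} {beta : probability (measurableTypeR R) R}.
Context {zeta xi : R -> R} {a : nat -> R} {omega : R -> R} {theta0 : R}.
Hypothesis nparam0 : natural_parameter beta 0.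
Hypothesis nondegenerate : not_concentrated_on_one_point beta.
Hypothesis sep : separable_at beta theta0 zeta xi a.
Hypothesis adm : admissible omega.
Local Notation mu := (@lebesgue_measure R).
Local Notation D := (`[(-1 : R), 1]%classic : set R).

Let a_neq0 := separable_a_neq0 sep.
Let factor := separable_moment sep.

(** [xi 0] is not 0, so that [t * xi 0] takes every real value r. *)
Lemma cvg_coefficient_series (r : R) :
  cvgn (series (fun n => `|r| ^+ n / (`|a n| * n`!%:R))).
Proof.
have x0 : xi 0 != 0 := xi0_neq0 nparam0 nondegenerate a_neq0 factor.
rewrite (_ : (fun n => _) = (fun n =>
    `|(r / xi 0) ^+ n * xi 0 ^+ n / (a n * n`!%:R)|)).
  exact: (@separable_abs_cvg _ _ _ _ _ _ sep (r / xi 0) 0 nparam0).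
apply/funext => n /=.
by rewrite -exprMn divfK// normrM normrX normfV normrM normr_nat.
Qed.

(** The coefficient of [x^n] in the integrand of the kernel, weight omega
    apart. *)
Definition kernel_weight (t s : R) (n : nat) : R :=
  (- t * s) ^+ n * cos (pi / 2 * n%:R + t * s * xi theta0) / (a n * n`!%:R).

Lemma kernel_termE (t x s : R) (n : nat) :
  kernel_term xi a theta0 t x s n = x ^+ n * kernel_weight t s n.
Proof. by rewrite /kernel_term /kernel_weight exprMn; ring. Qed.

Lemma measurable_kernel_weight (t : R) (n : nat) :
  measurable_fun setT (kernel_weight t ^~ n).
Proof.
have mts : measurable_fun setT (fun s : R => t * s * xi theta0).
  by apply: measurable_funM => //; exact: measurable_funM.
apply: measurable_funM => //; apply: measurable_funM.
  by apply: measurable_funX; exact: measurable_funM.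
apply: measurableT_comp.
  by apply: continuous_measurable_fun; exact: continuous_cos.
exact: measurable_funD.
Qed.

Lemma kernel_weight_le (t s : R) (n : nat) : s \in `[-1, 1] ->
  `|kernel_weight t s n| <= `|t| ^+ n / (`|a n| * n`!%:R).
Proof.
rewrite in_itv /= => s1.
rewrite /kernel_weight !normrM normfV normrM normr_nat.
rewrite ler_wpM2r ?invr_ge0 ?mulr_ge0// normrX normrM normrN.
rewrite -[leRHS]mulr1 ler_pM ?exprn_ge0 ?mulr_ge0// ?cos_max//.
rewrite lerXn2r ?nnegrE ?mulr_ge0// ler_piMr//.
by rewrite ler_norml.
Qed.

Lemma kernel_term_le (t x s : R) (n : nat) : s \in `[-1, 1] ->
  `|kernel_term xi a theta0 t x s n| <= `|t * x| ^+ n / (`|a n| * n`!%:R).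
Proof.
move=> Ds; rewrite kernel_termE normrM normrX.
rewrite (_ : _ / _ = `|x| ^+ n * (`|t| ^+ n / (`|a n| * n`!%:R))).
  by rewrite ler_wpM2l ?exprn_ge0// kernel_weight_le.
by rewrite normrM exprMn; ring.
Qed.

Lemma cvg_kernel_term (t x s : R) : s \in `[-1, 1] ->
  cvgn (series (kernel_term xi a theta0 t x s)).
Proof.
move=> Ds; apply: normed_cvg.
apply: (@series_le_cvg _ _ (fun n => `|t * x| ^+ n / (`|a n| * n`!%:R))) => n.
- exact: normr_ge0.
- by rewrite divr_ge0// ?exprn_ge0// mulr_ge0.
- exact: kernel_term_le.
- exact: cvg_coefficient_series.
Qed.

Lemma integrable_kernel_weight (t : R) (n : nat) :
  mu.-integrable D (EFin \o (fun s => kernel_weight t s n * omega s)).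
Proof.
have [H _ _ _] := integral_weighted_series adm
  (fun n s => kernel_weight t s n)
  (fun n => `|t| ^+ n / (`|a n| * n`!%:R)) (measurable_kernel_weight t)
  (fun n s => kernel_weight_le t s n) (cvg_coefficient_series t).
exact: H.
Qed.

Definition kernel_coefficient (t : R) (n : nat) : R :=
  (zeta theta0)^-1 * \int[mu]_(s in D) (kernel_weight t s n * omega s).

Lemma kernel_coefficient_le (t : R) (n : nat) :
  `|kernel_coefficient t n| <=
    `|zeta theta0|^-1 * (`|t| ^+ n / (`|a n| * n`!%:R)).
Proof.
rewrite /kernel_coefficient normrM normfV ler_wpM2l ?invr_ge0//.
have [_ H _ _] := integral_weighted_series adm (fun n s => kernel_weight t s n)
  (fun n => `|t| ^+ n / (`|a n| * n`!%:R)) (measurable_kernel_weight t)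
  (fun n s => kernel_weight_le t s n) (cvg_coefficient_series t).
exact: H.
Qed.

(** The variable x only enters the kernel through its powers, so integrating
    in s term by term exhibits it as a power series; in particular it is
    measurable. *)
Lemma kernel_expansion (t x : R) :
  mu.-integrable D (EFin \o kernel_integrand xi a omega theta0 t x) /\
  series (fun n => kernel_coefficient t n * x ^+ n) @ \oo -->
    K zeta xi a omega theta0 t x.
Proof.
have mk n : measurable_fun setT (fun s => kernel_term xi a theta0 t x s n).
  rewrite (_ : (fun s => _) = (fun s => x ^+ n * kernel_weight t s n)).
    by apply: measurable_funM => //; exact: measurable_kernel_weight.
  by apply/funext => s; rewrite kernel_termE.
have [_ _ H1 H2] := integral_weighted_series adm
  (fun n s => kernel_term xi a theta0 t x s n)
  (fun n => `|t * x| ^+ n / (`|a n| * n`!%:R)) mk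
  (fun n s => kernel_term_le t x s n) (cvg_coefficient_series (t * x)).
split; first exact: H1.
have -> : (fun n => kernel_coefficient t n * x ^+ n) = (zeta theta0)^-1 *:
   (fun n => \int[mu]_(s in D) (kernel_term xi a theta0 t x s n * omega s)).
  apply/funext => n; rewrite fctE /GRing.scale /= /kernel_coefficient -mulrA.
  congr (_ * _).
  rewrite mulrC -(RintegralZl _ _ (integrable_kernel_weight t n))//.
  by apply: eq_Rintegral => s _; rewrite kernel_termE mulrA.
rewrite seriesZ; exact: cvgZr H2.
Qed.

Lemma KE (t : R) : K zeta xi a omega theta0 t =
  (fun x => limn (series (fun n => kernel_coefficient t n * x ^+ n))).
Proof.
by apply/funext => x; have [_ /cvg_lim->] := kernel_expansion t x.
Qed.

(** Here [a_n] cancels: [nef_normX_le] bounds the n-th term by a multiple of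
    [(|t| r)^n / n!], which sums to an exponential. *)
Lemma psi_series (t : R) {theta : R} : natural_parameter beta theta ->
  (nef beta theta).-integrable setT (EFin \o K zeta xi a omega theta0 t) /\
  series (fun n => kernel_coefficient t n * moment beta n theta) @ \oo -->
    psi beta zeta xi a omega theta0 t theta.
Proof.
move=> nt.
have [C [r [C0 r0 Hr]]] := nef_normX_le nparam0 nondegenerate a_neq0
  factor nt.
pose z : R := `|zeta theta0|^-1.
have z0 : 0 <= z by rewrite invr_ge0.
have mf n : measurable_fun setT (fun x : measurableTypeR R =>
    kernel_coefficient t n * (x : R) ^+ n).
  by apply: measurable_funM => //; exact: exprn_measurable.
have [||x _|] := integral_series (nef beta theta) setT
  (fun n x => kernel_coefficient t n * (x : R) ^+ n)
  (fun n => z * C * exp_coeff (`|t| * r) n) measurableT mf.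
- move=> n.
  under eq_integral do rewrite normrM normrX EFinM.
  have iX := nef_integrable_normX beta n nt.
  rewrite ge0_integralZl//; last by case/integrableP: iX.
  rewrite -[X in (_ * X)%E]fineK; last first.
    exact: (integrable_fin_num measurableT iX).
  rewrite -EFinM lee_fin.
  apply: (@le_trans _ _ (z * (`|t| ^+ n / (`|a n| * n`!%:R)) *
      (C * r ^+ n * `|a n|))).
    rewrite ler_pM//; [|exact: kernel_coefficient_le|exact: Hr].
    apply: fine_ge0; apply: integral_ge0 => x _.
    by rewrite lee_fin exprn_ge0.
  rewrite le_eqVlt; apply/orP; left; apply/eqP.
  rewrite /exp_coeff /= exprMn.
  have an : `|a n| != 0 by rewrite normr_eq0.
  have fn : n`!%:R != 0 :> R by rewrite pnatr_eq0 -lt0n fact_gt0.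
  by field; apply/andP.
- rewrite (_ : (fun n => _) = (z * C) *: exp_coeff (`|t| * r));
    last exact/funext.
  by apply: is_cvg_seriesZ; exact: is_cvg_series_exp_coeff.
- apply: (@series_le_cvg _ _
    (z *: (fun n => `|t * x| ^+ n / (`|a n| * n`!%:R)))).
  + by move=> n; exact: normr_ge0.
  + by move=> n; rewrite mulr_ge0// divr_ge0 ?exprn_ge0// mulr_ge0.
  + move=> n; rewrite /= fctE normrM normrX.
    rewrite [leRHS](_ : _ = z * (`|t| ^+ n / (`|a n| * n`!%:R)) * `|x| ^+ n).
      by rewrite ler_wpM2r ?exprn_ge0// kernel_coefficient_le.
    by rewrite /GRing.scale /= normrM exprMn; ring.
  + by apply: is_cvg_seriesZ; exact: cvg_coefficient_series.
- move=> H1 H2; split; first by rewrite KE.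
  rewrite (_ : (fun n => _) = (fun n =>
      \int[nef beta theta]_x (kernel_coefficient t n * (x : R) ^+ n))).
    by rewrite /psi KE; exact: H2.
  apply/funext => n; have [iX _] := nef_momentE beta n nt.
  by rewrite (RintegralZl _ measurableT iX).
Qed.

(** By separability the n-th term of [psi_series] is [zeta theta / zeta theta0]
    times the weighted integral of
    [(- t s xi(theta))^n cos(pi n / 2 + t s xi(theta0)) / n!]; summing under the
    integral, [cos_taylor] applies. *)
Lemma psiE (t : R) {theta : R} : natural_parameter beta theta ->
  psi beta zeta xi a omega theta0 t theta = zeta theta / zeta theta0 *
    \int[mu]_(s in D) (cos (t * s * (xi theta0 - xi theta)) * omega s).
Proof.
move=> nt; have [_ H] := psi_series t nt.
pose h n (s : R) : R := (- t * s * xi theta) ^+ n *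
  cos (pi / 2 * n%:R + t * s * xi theta0) / n`!%:R.
have hE n s : h n s = xi theta ^+ n * a n * kernel_weight t s n.
  rewrite /h /kernel_weight exprMn.
  have fn : n`!%:R != 0 :> R by rewrite pnatr_eq0 -lt0n fact_gt0.
  have an := a_neq0 n.
  by field; apply/andP.
have mh n : measurable_fun setT (h n).
  rewrite (_ : h n = (fun s => xi theta ^+ n * a n * kernel_weight t s n)).
    by apply: measurable_funM => //; exact: measurable_kernel_weight.
  by apply/funext => s; rewrite hE.
have hB n s : s \in `[-1, 1] -> `|h n s| <= exp_coeff (`|xi theta| * `|t|) n.
  move=> Ds; rewrite hE normrM (normrM (xi theta ^+ n)) normrX.
  apply: (@le_trans _ _ (`|xi theta| ^+ n * `|a n| *
      (`|t| ^+ n / (`|a n| * n`!%:R)))).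
    by rewrite ler_wpM2l ?mulr_ge0 ?exprn_ge0// kernel_weight_le.
  rewrite le_eqVlt; apply/orP; left; apply/eqP.
  rewrite /exp_coeff /= exprMn.
  have an : `|a n| != 0 by rewrite normr_eq0.
  have fn : n`!%:R != 0 :> R by rewrite pnatr_eq0 -lt0n fact_gt0.
  by field; apply/andP.
have [_ _ _ H2] := integral_weighted_series adm h _ mh hB
  (is_cvg_series_exp_coeff _).
have hcos s : limn (series (h ^~ s)) = cos (t * s * (xi theta0 - xi theta)).
  rewrite (_ : _ * (_ - _) = - t * s * xi theta + t * s * xi theta0); last ring.
  exact: (cvg_lim _ (cos_taylor _ _ _)).
have E : (fun n => kernel_coefficient t n * moment beta n theta) =
    (zeta theta / zeta theta0) *:
    (fun n => \int[mu]_(s in D) (h n s * omega s)).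
  apply/funext => n; rewrite fctE /GRing.scale /= factor// /kernel_coefficient.
  set I : R := \int[mu]_(s in D) (kernel_weight t s n * omega s).
  have -> : \int[mu]_(s in D) (h n s * omega s) = xi theta ^+ n * a n * I.
    rewrite -(RintegralZl _ _ (integrable_kernel_weight t n))//.
    by apply: eq_Rintegral => s _; rewrite hE mulrA.
  by ring.
rewrite E seriesZ in H.
suff -> : psi beta zeta xi a omega theta0 t theta = zeta theta / zeta theta0 *
    \int[mu]_(s in D) (limn (series (h ^~ s)) * omega s).
  by congr (_ * _); apply: eq_Rintegral => s _; rewrite hcos.
by apply: (cvg_unique _ H) => //; exact: cvgZr H2.
Qed.

End kernel.

(** * The Riemann-Lebesgue lemma on [-1, 1] *)

Section riemann_lebesgue.
Context {R : realType}.
Local Notation mu := (@lebesgue_measure R).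
Local Notation D := (`[(-1 : R), 1]%classic : set R).

Definition inner (f g : R -> R) : R := \int[mu]_(s in D) (f s * g s).

Definition wave (lambda s : R) : R := cos (lambda * s).

Let mD : measurable (D : set (measurableTypeR R)).
Proof. exact: measurable_itv. Qed.

Lemma bounded_measurableM {f g : R -> R} :
  bounded_measurable f -> bounded_measurable g ->
  bounded_measurable (fun s => f s * g s).
Proof.
move=> [mf [M fM]] [mg [N gN]]; split; first exact: measurable_funM.
by exists (M * N) => s Ds; rewrite normrM ler_pM ?fM ?gN.
Qed.

Lemma bounded_measurableDZ {f g : R -> R} (x : R) :
  bounded_measurable f -> bounded_measurable g ->
  bounded_measurable (fun s => f s + x * g s).
Proof.
move=> [mf [M fM]] [mg [N gN]]; split.
  by apply: measurable_funD => //; exact: measurable_funM.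
exists (M + `|x| * N) => s Ds; apply: (le_trans (ler_normD _ _)).
by rewrite lerD ?fM// normrM ler_wpM2l ?gN.
Qed.

Lemma bounded_measurable_wave lambda : bounded_measurable (wave lambda).
Proof.
split; last by exists 1 => s _; exact: cos_max.
apply: measurable_funTS; apply: measurableT_comp; last exact: mulrl_measurable.
by apply: continuous_measurable_fun; exact: continuous_cos.
Qed.

Lemma innerC f g : inner f g = inner g f.
Proof. by apply: eq_Rintegral => s _; rewrite mulrC. Qed.

Lemma innerDZ f g h (x : R) : bounded_measurable f -> bounded_measurable g ->
  bounded_measurable h ->
  inner (fun s => f s + x * g s) h = inner f h + x * inner g h.
Proof.
move=> bf bg bh.
have ifh := bounded_measurable_integrable (bounded_measurableM bf bh).
have igh := bounded_measurable_integrable (bounded_measurableM bg bh).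
have ixgh : mu.-integrable D (EFin \o (fun s => x * (g s * h s))).
  exact: (integrableZl mD x igh).
rewrite /inner -(RintegralZl _ mD igh) -(RintegralD mD ifh ixgh).
by apply: eq_Rintegral => s _; ring.
Qed.

Lemma inner_waveE (lambda nu : R) :
  inner (wave lambda) (wave nu) =
  2^-1 * \int[mu]_(s in D) cos ((nu - lambda) * s) +
  2^-1 * \int[mu]_(s in D) cos ((nu + lambda) * s).
Proof.
have i k := bounded_measurable_integrable (bounded_measurable_wave k).
have iZ k : mu.-integrable D (EFin \o (fun s => 2^-1 * wave k s)).
  exact: (integrableZl mD 2^-1 (i k)).
rewrite -(RintegralZl _ mD (i _)) -(RintegralZl _ mD (i _)).
rewrite -(RintegralD mD (iZ _) (iZ _)); apply: eq_Rintegral => s _.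
by rewrite /wave mulrBl mulrDl cosB cosD; field.
Qed.

Lemma integral_cos_le (k : R) : 0 < k ->
  `|\int[mu]_(s in D) cos (k * s)| <= 2 / k.
Proof.
move=> k0.
pose F (s : R) := sin (k * s) / k.
have dF (s : R) : is_derive s 1 F (cos (k * s)).
  rewrite /F; apply: is_derive_eq.
  by rewrite /GRing.scale /= ; field; rewrite gt_eqF.
have cF : continuous F.
  by move=> s; exact/differentiable_continuous/derivable1_diffP.
have -> : \int[mu]_(s in D) cos (k * s) = F 1 - F (-1).
  rewrite /Rintegral (@continuous_FTC2 _ _ F)//.
  - apply: continuous_subspaceT => s.
    apply: continuous_comp; last exact: continuous_cos.
    exact: mulrl_continuous.
  - split => //.
    + by apply: cvg_at_right_filter; exact: cF.
    + by apply: cvg_at_left_filter; exact: cF.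
  - by move=> s _; rewrite derive1E derive_val.
have F2 : `|sin (k * 1) - sin (k * -1)| <= 2.
  apply: (le_trans (ler_normB _ _)).
  by rewrite -[leRHS]/(1 + 1) lerD// sin_max.
by rewrite /F -mulrBl normrM normfV (gtr0_norm k0) ler_pM2r ?invr_gt0.
Qed.

(** Almost orthogonality of waves of distant frequencies, from [inner_waveE]
    and the decay of [integral_cos_le]. *)
Lemma inner_wave_cvg0 (lambda : R) :
  inner (wave lambda) (wave nu) @[nu --> +oo] --> 0.
Proof.
apply/cvgr0Pnorm_le => e e0; near=> nu.
have n1 : 2 / e <= nu - lambda.
  by rewrite lerBrDr; near: nu; apply: nbhs_pinfty_ge; rewrite num_real.
have n2 : 2 / e <= nu + lambda.
  by rewrite -lerBlDr; near: nu; apply: nbhs_pinfty_ge; rewrite num_real.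
have key k : 2 / e <= k -> `|2^-1 * \int[mu]_(s in D) cos (k * s)| <= e / 2.
  move=> ek; have k0 : 0 < k by apply: lt_le_trans ek; rewrite divr_gt0.
  rewrite normrM (ger0_norm (_ : 0 <= 2^-1))// mulrC ler_pM2r ?invr_gt0//.
  apply: (le_trans (integral_cos_le k k0)).
  by rewrite ler_pdivrMr// mulrC -ler_pdivrMr.
rewrite inner_waveE; apply: (le_trans (ler_normD _ _)).
by rewrite [e]splitr lerD// key.
Unshelve. all: by end_near. Qed.

Lemma inner_wave_norm (lambda : R) : inner (wave lambda) (wave lambda) <= 2.
Proof.
have b := bounded_measurable_wave lambda.
have ib := bounded_measurable_integrable (bounded_measurableM b b).
have i1 : mu.-integrable D (EFin \o cst (1 : R)).
  apply: bounded_measurable_integrable; split => //.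
  by exists 1 => s _; rewrite normr1.
apply: (@le_trans _ _ (\int[mu]_(s in D) 1)).
  apply: le_Rintegral => // s _; rewrite -expr2 -[leLHS]ger0_norm ?sqr_ge0//.
  by rewrite normrX expr_le1// cos_max.
have -> : \int[mu]_(s in D) 1 = 1 * fine (mu D) by exact: Rintegral_cst.
by rewrite mul1r lebesgue_measure_itv; case: ifP => _ //=; lra.
Qed.

(** Energy decrement.  Suppose that [inner w (wave lambda)] is at least e in
    absolute value for arbitrarily large lambda.  If p is a finite combination
    of waves, its inner products with waves of high frequency are small, so
    that the residue [w - p] still has an inner product y with some wave with
    [|y| >= e / 2].  Subtracting [y / 2] times this wave from the residue
    lowers its energy by at least [y^2 / 2 >= e^2 / 8], as the energy of a wave
    is at most 2.  This can be repeated forever, but the energy is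
    nonnegative. *)
Lemma riemann_lebesgue (w : R -> R) : bounded_measurable w ->
  inner w (wave lambda) @[lambda --> +oo] --> 0.
Proof.
move=> bw; apply/cvgr0Pnorm_lt => e e0; apply: contrapT => notnear.
have step n : exists p, [/\ bounded_measurable p,
    inner p (wave lambda) @[lambda --> +oo] --> 0 &
    inner (fun s => w s + (-1) * p s) (fun s => w s + (-1) * p s)
      <= inner w w - n%:R * (e ^+ 2 / 8)].
  elim: n => [|n [p [bp cp Ep]]].
    exists (fun=> 0); split.
    - by split=> //; exists 0 => s _; rewrite normr0.
    - rewrite (_ : (fun=> _) = fun=> 0); first exact: cvg_cst.
      apply/funext => l; rewrite /inner (@eq_Rintegral _ _ _ _ _ (cst 0)).
        by rewrite Rintegral_cst// mul0r.
      by move=> s _; rewrite mul0r.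
    - rewrite mul0r subr0 le_eqVlt; apply/orP; left; apply/eqP.
      by apply: eq_Rintegral => s _; rewrite mulr0 addr0.
  have [lambda [pl wl]] : exists lambda,
      `|inner p (wave lambda)| < e / 2 /\ e <= `|inner w (wave lambda)|.
    apply: contrapT => nex; apply: notnear.
    have e20 : 0 < e / 2 by rewrite divr_gt0.
    move/cvgr0_norm_lt: (cp) => /(_ _ e20); apply: filterS => l /= pl.
    rewrite ltNge; apply/negP => wl; apply: nex; by exists l.
  pose q s := w s + (-1) * p s.
  have bq : bounded_measurable q by exact: bounded_measurableDZ.
  have bl := bounded_measurable_wave lambda.
  pose y := inner q (wave lambda).
  have yE : y = inner w (wave lambda) - inner p (wave lambda).
    by rewrite /y innerDZ// mulN1r.
  have ye : e / 2 <= `|y|.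
    by rewrite yE; apply: le_trans (lerB_dist _ _); lra.
  (* The coefficient y / 2 minimises the bound - 2 x y + 2 x ^+ 2 of the
     increase of the energy. *)
  pose x := y / 2.
  exists (fun s => p s + x * wave lambda s); split.
  - exact: bounded_measurableDZ.
  - rewrite (_ : (fun l => _) = (fun l => inner p (wave l) +
        x * inner (wave lambda) (wave l))).
      rewrite -[X in _ --> X](addr0 0) -[X in _ --> _ + X](mulr0 x).
      apply: cvgD => //; apply: cvgMr; exact: inner_wave_cvg0.
    by apply/funext => l; rewrite innerDZ//; exact: bounded_measurable_wave.
  - have -> : (fun s => w s + (-1) * (p s + x * wave lambda s)) =
        (fun s => q s + (- x) * wave lambda s).
      by apply/funext => s; rewrite /q; ring.
    have bqx : bounded_measurable (fun s => q s + (- x) * wave lambda s).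
      exact: bounded_measurableDZ.
    rewrite (innerDZ q)// (innerC q) (innerC (wave lambda)) !(innerDZ q)//.
    rewrite (innerC (wave lambda) q) -/y.
    have W2 := inner_wave_norm lambda.
    have y2 : e ^+ 2 / 4 <= y ^+ 2.
      rewrite -[y ^+ 2]ger0_norm ?sqr_ge0// normrX.
      rewrite (_ : e ^+ 2 / 4 = (e / 2) ^+ 2); last by field.
      by rewrite lerXn2r ?nnegrE// divr_ge0// ltW.
    rewrite -/(inner q q) in Ep.
    have X2 : x ^+ 2 * inner (wave lambda) (wave lambda) <= x ^+ 2 * 2.
      by rewrite ler_wpM2l// sqr_ge0.
    have x2 : x ^+ 2 * 2 = y ^+ 2 / 2 by rewrite /x; field.
    have xy : x * y = y ^+ 2 / 2 by rewrite /x; field.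
    rewrite x2 in X2; rewrite -natr1.
    rewrite [leLHS](_ : _ = inner q q - 2 * (x * y) +
      x ^+ 2 * inner (wave lambda) (wave lambda)); last ring.
    by rewrite xy mulrDl mul1r; lra.
pose n := (Num.truncn (inner w w / (e ^+ 2 / 8))).+1.
have [p [_ _ Ep]] := step n.
have : 0 <= inner (fun s => w s + (-1) * p s) (fun s => w s + (-1) * p s).
  by apply: Rintegral_ge0 => s _; rewrite -expr2 sqr_ge0.
apply/negP; rewrite -ltNge; apply: (le_lt_trans Ep).
rewrite subr_lt0 -ltr_pdivrMr ?divr_gt0 ?exprn_gt0//.
exact: truncnS_gt.
Qed.

End riemann_lebesgue.

(** * The mean of the kernel and its limit *)

Theorem theorem5 (R : realType) (beta : probability (measurableTypeR R) R)
    (zeta xi : R -> R) (a : nat -> R) (omega : R -> R) (theta0 : R) :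
  not_concentrated_on_one_point beta ->
  finite_moments beta ->
  natural_parameter beta 0 ->
  ~ location_shift_family beta ->
  continuous_members beta ->
  natural_parameter beta theta0 ->
  separable_at beta theta0 zeta xi a ->
  admissible omega ->
  [/\ (* well-definedness of the series and integrals defining K and psi *)
      [/\ forall t x s : R, s \in `[-1, 1] ->
            cvgn (series (kernel_term xi a theta0 t x s)),
          forall t x : R, lebesgue_measure.-integrable `[(-1 : R), 1]
            (EFin \o kernel_integrand xi a omega theta0 t x) &
          forall t theta : R, natural_parameter beta theta ->
            (nef beta theta).-integrable [set: R]
              (EFin \o K zeta xi a omega theta0 t)],
      forall t theta : R, natural_parameter beta theta ->
        psi beta zeta xi a omega theta0 t theta =
          zeta theta / zeta theta0 *
          (\int[lebesgue_measure]_(s in `[(-1 : R), 1])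
             (cos (t * s * (xi theta0 - xi theta)) * omega s))%R,
      forall t : R, psi beta zeta xi a omega theta0 t theta0 = 1 &
      forall theta : R, natural_parameter beta theta -> theta != theta0 ->
        psi beta zeta xi a omega theta0 t theta @[t --> +oo] --> 0].
Proof.
move=> nondeg _ n0 _ _ nt0 sep adm.
have z0 : zeta theta0 != 0 := separable_zeta_neq0 sep nt0.
have formula t theta : natural_parameter beta theta ->
    psi beta zeta xi a omega theta0 t theta = zeta theta / zeta theta0 *
      \int[lebesgue_measure]_(s in `[(-1 : R), 1])
        (cos (t * s * (xi theta0 - xi theta)) * omega s).
  by move=> nt; exact: (psiE n0 nondeg sep adm t nt).
split; [split| exact: formula | |].
- exact: cvg_kernel_term n0 nondeg sep.
- by move=> t x; have [] := kernel_expansion n0 nondeg sep adm t x.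
- by move=> t theta nt;
    have [] := psi_series n0 nondeg sep adm t nt.
- move=> t; rewrite formula// divff// mul1r -[RHS](admissible_integral adm).
  by apply: eq_Rintegral => s _; rewrite subrr mulr0 cos0 mul1r.
- move=> theta nt neq.
  (* The frequency is taken positive, cos being even. *)
  pose delta := `|xi theta0 - xi theta|.
  have delta0 : 0 < delta.
    by rewrite normr_gt0 subr_eq0 eq_sym (separable_xi_neq sep).
  have -> : (fun t => psi beta zeta xi a omega theta0 t theta) =
      (fun t => zeta theta / zeta theta0 * inner omega (wave (t * delta))).
    apply/funext => t; rewrite formula//; congr (_ * _).
    apply: eq_Rintegral => s _; rewrite mulrC; congr (_ * _).
    rewrite /wave /delta; case: (ler0P (xi theta0 - xi theta)) => _.
      by rewrite -cosN; congr cos; ring.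
    by congr cos; ring.
  rewrite -[X in _ --> X](mulr0 (zeta theta / zeta theta0)).
  apply: cvgMr; apply: (cvg_comp (fun t => t * delta) (inner omega \o wave)).
    by apply: (gt0_cvgMly delta0); exact: cvg_id.
  exact: (riemann_lebesgue _ (admissible_bounded_measurable adm)).
Qed.
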